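(* Let $D$ be a full $1$-extension of a directed path, with added vertex $s$. If $s$ is a source or a sink of $D$, or if $D$ is $TT_3$, then $\mathrm{unv}(D)=2|V(D)|-2$. Otherwise $\mathrm{unv}(D)=2|V(D)|-3$.
   Context: A full $1$-extension of a directed path $P$ is an acyclic digraph $D$ with a vertex $s$ (the added vertex) such that $D-s=P$ and $s$ is adjacent (by an arc in one direction) to every vertex of $P$. $TT_3$ is the transitive tournament on 3 vertices. A digraph is $p$-unavoidable if it is contained in (isomorphic to a subdigraph of) every tournament of order $p$; $\mathrm{unv}(D)$ is the least such $p$. *)

(* Defs.v *)
From mathcomp Require Import all_boot.

Set Implicit Arguments.
Unset Strict Implicit.
Unset Printing Implicit Defensive.

(* A finite digraph is its arc relation on a finType of vertices.  Looplessness
   is not built in: it follows from [acyclic] and is required by [tournament]. *)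

Definition acyclic (V : finType) (D : rel V) : Prop :=
  forall c : seq V, cycle D c -> c = [::].

Definition digraph_iso (V W : finType) (D : rel V) (E : rel W) : Prop :=
  exists2 f : V -> W, bijective f & {mono f : x y / D x y >-> E x y}.

Definition dipath (n : nat) : rel 'I_n := fun i j => j == i.+1 :> nat.
Arguments dipath n : clear implicits.

(* The empty digraph is not a path. *)
Definition is_dipath (V : finType) (D : rel V) : Prop :=
  exists2 n, 0 < n & digraph_iso D (dipath n).

Definition del_vertex (V : finType) (D : rel V) (s : V) : rel {x : V | x != s} :=
  relpre val D.
Arguments del_vertex {V} D s.

Definition full_one_extension (V : finType) (D : rel V) (s : V) : Prop :=
  [/\ acyclic D,
      is_dipath (del_vertex D s)
    & forall x, x != s -> D s x (+) D x s].

Definition is_source (V : finType) (D : rel V) (s : V) : Prop :=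
  forall x, ~~ D x s.

Definition is_sink (V : finType) (D : rel V) (s : V) : Prop :=
  forall x, ~~ D s x.

Definition transitive_tournament (n : nat) : rel 'I_n := fun i j => i < j.
Arguments transitive_tournament n : clear implicits.

Definition tournament (T : finType) (E : rel T) : Prop :=
  irreflexive E /\ forall x y, x != y -> E x y (+) E y x.

(* The subdigraph need not be induced: it consists of the image of [f] and of
   the images of the arcs of [D]. *)
Definition contains (T V : finType) (E : rel T) (D : rel V) : Prop :=
  exists2 f : V -> T, injective f & {homo f : x y / D x y >-> E x y}.

Definition unavoidable (V : finType) (D : rel V) (p : nat) : Prop :=
  forall (T : finType) (E : rel T), tournament E -> #|T| = p -> contains E D.

(* [is_unv D m] states that unv(D) is defined and equal to m. *)
Definition is_unv (V : finType) (D : rel V) (m : nat) : Prop :=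
  unavoidable D m /\ forall p, unavoidable D p -> m <= p.

(* Main.v *)
Require Import Defs.
From mathcomp Require Import all_boot ssralg zmodp.
From mathcomp Require Import zify.

Set Implicit Arguments.
Unset Strict Implicit.
Unset Printing Implicit Defensive.

(* Write the path as v_0 ... v_{n-1}. By acyclicity v_i -> s exactly for i < k,
   for some k; put l = n - k.

   Lower bound: let a regular tournament on 2k - 1 vertices dominate a regular
   tournament on 2l - 1 vertices. No vertex has both indegree at least k and
   outdegree at least l, so none can play the role of s.

   Upper bound for 0 < k < n, n > 2 and order 2n - 1, supposing there is no
   copy. Given a vertex s, let X be the set of ends of k-vertex paths in the
   in-neighbourhood, Y the set of starts of l-vertex paths in the
   out-neighbourhood, and A, B the in- and out-neighbours left over. Then
   |A| < k, |B| < l, A dominates X, and Y dominates both X and B. If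
   |X| + |B| >= l, a vertex of Y with an in-neighbour in Y must have indegree
   less than k, since otherwise it is itself the centre of a copy; if
   |X| + |B| < l, all vertices of X have outdegree less than l.
   Take a maximal pair of disjoint sets H, Z containing the vertices of indegree
   less than k, resp. outdegree less than l, such that h in H has fewer than k
   in-neighbours outside Z and z in Z fewer than l out-neighbours outside H.
   By maximality a vertex s outside H and Z has at least k in-neighbours outside
   Z, so X is not contained in Z; hence |X| + |B| >= l and Y has at most one
   vertex outside H. Dually X has at most one vertex outside Z. So s has at
   least |X| + |Y| - 2 >= n - 2 arcs to H or from Z, and summing over all such s
   exceeds the number of arcs that H and Z can receive, resp. emit. *)

(** * Neighbourhoods, path starts and copies of the extension *)

Definition converse (T : finType) (E : rel T) : rel T := fun x y => E y x.

Definition outs (T : finType) (E : rel T) (v : T) : {set T} := [set x | E v x].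

Notation ins E v := (outs (converse E) v).

(* The bound [m] counts arcs: these are the starts of paths on [m.+1] vertices. *)
Definition starts (T : finType) (E : rel T) (S : {set T}) (m : nat) : {set T} :=
  [set y | [exists p : m.-tuple T,
     [&& path E y p, uniq (y :: p) & all (mem S) (y :: p)]]].

(* Sortedness of [p ++ q] includes the arc from the end of [p] to the start of
   [q]. *)
Definition extension_at (T : finType) (E : rel T) (c : T) (p q : seq T) : bool :=
  [&& uniq (p ++ q), sorted E (p ++ q), all (mem (ins E c)) p
    & all (mem (outs E c)) q].

(** Tuples make this a boolean, so that one can argue by contradiction. *)
Definition has_extension (T : finType) (E : rel T) (k l : nat) : bool :=
  [exists c, exists p : k.-tuple T, exists q : l.-tuple T, extension_at E c p q].

(** * Paths in tournaments *)

Section Tournament.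

Variables (T : finType) (E : rel T).
Hypothesis tourE : tournament E.

Lemma tournament_converse : tournament (converse E).
Proof.
have [irr tot] := tourE; split=> [x|x y neq]; first exact: irr.
by rewrite addbC; apply: tot.
Qed.

Lemma tournament_irr x : E x x = false.
Proof. by case: tourE => irr _; apply: irr. Qed.

Lemma tournament_neg x y : x != y -> ~~ E x y -> E y x.
Proof. by move=> neq; have := (proj2 tourE) x y neq; case: (E x y). Qed.

Lemma tournament_asym x y : E x y -> E y x -> False.
Proof.
move=> Exy Eyx; case: (eqVneq x y) Exy => [->|neq Exy]; first by rewrite tournament_irr.
by have := (proj2 tourE) x y neq; rewrite Exy Eyx.
Qed.

Lemma extensionP k l :
  reflect (exists c p q, [/\ size p = k, size q = l & extension_at E c p q])
    (has_extension E k l).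
Proof.
apply: (iffP existsP) => [[c /existsP[p /existsP[q ext]]]|[c [p [q [sp sq ext]]]]].
  by exists c, p, q; rewrite !size_tuple.
have sp' : size p == k by rewrite sp.
have sq' : size q == l by rewrite sq.
by exists c; apply/existsP; exists (Tuple sp'); apply/existsP; exists (Tuple sq').
Qed.

Lemma outs_ins_disjoint c : [disjoint ins E c & outs E c].
Proof.
apply/pred0P => x /=; rewrite !inE; apply/negP => /andP[Exc Ecx].
exact: tournament_asym Ecx.
Qed.

(** Keeping the last [k] vertices of [p] and the first [l] of [q] preserves the arc at the junction.
    The two parts are disjoint because they lie on different sides of [c]. *)
Lemma long_extension k l c p q : k <= size p -> l <= size q -> uniq p -> uniq q ->
  sorted E (p ++ q) -> {subset p <= ins E c} -> {subset q <= outs E c} ->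
  has_extension E k l.
Proof.
move=> kp lq up uq spq pin qout; apply/extensionP.
exists c, (drop (size p - k) p), (take l q).
rewrite size_drop subKn // size_takel //; split=> //; apply/and4P; split.
- rewrite cat_uniq drop_uniq // take_uniq // andbT; apply/hasPn => x /mem_take /qout xq.
  by apply/negP => /mem_drop /pin; rewrite (disjointFl (outs_ins_disjoint c) xq).
- move: spq; rewrite -{1}(cat_take_drop (size p - k) p) -{1}(cat_take_drop l q).
  by rewrite -!catA => /cat_sorted2[_]; rewrite catA => /cat_sorted2[].
- by apply/allP => x /mem_drop; apply: pin.
- by apply/allP => x /mem_take; apply: qout.
Qed.

Lemma sorted_join p q : sorted E p -> sorted E q ->
  (forall p' x y q', p = rcons p' x -> q = y :: q' -> E x y) -> sorted E (p ++ q).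
Proof.
case/lastP: p => [//|p x] sp; case: q => [|y q] sq link; first by rewrite cats0.
have Exy : E x y by exact: link.
by case: p sp {link} => [|z p] /= sp; rewrite ?Exy // cat_path sp last_rcons /= Exy.
Qed.

(** Put [u] right after an in-neighbour whose successor is an out-neighbour of [u]. If the successor
    is not one, it is itself an in-neighbour and the search moves on, at worst to the end of the
    path. The first vertex [z] never changes. *)
Lemma insert_path z q u : path E z q -> u \notin z :: q -> has (E^~ u) (z :: q) ->
  exists2 q', path E z q' & perm_eq q' (u :: q).
Proof.
elim: q z => [|y q IH] z /=.
  by move=> _ _; rewrite orbF => Ezu; exists [:: u]; rewrite /= ?Ezu.
move=> /andP[Ezy pq]; rewrite !inE !negb_or => /and3P[uz uy uq] hasu.
have [/andP[Ezu Euy]|nE] := boolP (E z u && E u y).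
  by exists [:: u, y & q] => //=; rewrite Ezu Euy.
have {}hasu : has (E^~ u) (y :: q).
  case/orP: hasu => // Ezu; apply/orP; left.
  by apply: tournament_neg => //; move: nE; rewrite Ezu.
have unq : u \notin y :: q by rewrite inE negb_or uy.
have [q' pq' eq'] := IH y pq unq hasu.
exists (y :: q'); first by rewrite /= Ezy.
by rewrite (perm_trans (_ : perm_eq _ (y :: u :: q))) ?perm_cons // (perm_catCA [:: y] [:: u]).
Qed.

(** The vertices of [r] are inserted one by one; each has its predecessor along [w :: r] as an
    in-neighbour already on the path. *)
Lemma extend_path z q w r : path E z q -> w \in z :: q -> path E w r ->
  uniq (z :: q ++ r) -> exists2 q', path E z q' & perm_eq q' (q ++ r).
Proof.
elim: r q w => [|u r IH] q w pq wq; first by exists q; rewrite ?cats0.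
move=> /andP[Ewu pr] uq.
have unq : u \notin z :: q.
  by move: uq; rewrite -cat_cons cat_uniq => /and3P[_ /norP[]].
have [q1 pq1 eq1] : exists2 q', path E z q' & perm_eq q' (u :: q).
  by apply: insert_path => //; apply/hasP; exists w.
have eq2 : perm_eq (q1 ++ r) (q ++ u :: r).
  by rewrite (perm_trans (_ : perm_eq _ ((u :: q) ++ r))) ?perm_cat2r //= perm_sym perm_catC /= perm_cons perm_catC.
have uq1 : u \in z :: q1 by rewrite inE (perm_mem eq1) mem_head orbT.
have [|q' pq' eq'] := IH q1 u pq1 uq1 pr.
  by rewrite (perm_uniq (_ : perm_eq _ (z :: q ++ u :: r))) ?perm_cons.
by exists q' => //; apply: perm_trans eq2.
Qed.

(** Rédei's theorem, by induction: a vertex with an in-neighbour on the path is inserted, any other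
    goes to the front. *)
Lemma hamiltonian_path (S : {set T}) :
  exists p, [/\ uniq p, p =i S & sorted E p].
Proof.
have [p [up ep sp]] : exists p, [/\ uniq p, p =i enum S & sorted E p].
  elim: (enum S) (enum_uniq S) => [_|u s IH /=]; first by exists [::].
  case/andP=> us uqs.
  have [p [up ep sp]] := IH uqs.
  have {}us : u \notin p by rewrite ep.
  case: p up ep sp us => [|z q] up ep sp us.
    by exists [:: u]; split=> // x; rewrite !inE -ep in_nil orbF.
  have [hasu|nhas] := boolP (has (E^~ u) (z :: q)).
    have [q' pq' eq'] := insert_path sp us hasu.
    have pe : perm_eq (z :: q') (u :: z :: q).
      by rewrite (perm_trans (_ : perm_eq _ (z :: u :: q))) ?perm_cons // (perm_catCA [:: z] [:: u]).
    exists (z :: q'); split=> //; first by rewrite (perm_uniq pe) cons_uniq us.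
    by move=> x; rewrite (perm_mem pe) inE ep -in_cons.
  exists [:: u, z & q]; split=> /=; first by rewrite us.
    by move=> x; rewrite inE ep -in_cons.
  rewrite -[path E z q]/(sorted E (z :: q)) sp andbT; move: us nhas; rewrite inE negb_or /= => /andP[uz _] /norP[nz _].
  by apply: tournament_neg nz; rewrite eq_sym.
by exists p; split=> // x; rewrite ep mem_enum.
Qed.

Lemma startsP (S : {set T}) m y :
  reflect (exists p, [/\ size p = m, path E y p, uniq (y :: p) & {subset y :: p <= S}])
    (y \in starts E S m).
Proof.
rewrite inE; apply: (iffP existsP) => [[p /and3P[pp up /allP sp]]|[p [sp pp up subp]]].
  by exists p; rewrite size_tuple.
have sp' : size p == m by rewrite sp.
exists (Tuple sp'); rewrite pp up; apply/allP => x; exact: subp.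
Qed.

Lemma starts_sub (S : {set T}) m : starts E S m \subset S.
Proof. by apply/subsetP => y /startsP[p [_ _ _ sub]]; apply: sub; rewrite mem_head. Qed.

(** With more than [m] vertices left over, a Hamiltonian path of them would begin at a start. *)
Lemma card_not_starts (S : {set T}) m : #|S :\: starts E S m| <= m.
Proof.
rewrite leqNgt; apply/negP => ltm.
have [[|y p] [up ep sp]] := hamiltonian_path (S :\: starts E S m).
  by rewrite (eq_card0 (A := _ :\: _)) // in ltm => x; rewrite -ep.
have szp : m <= size p.
  by rewrite -ltnS -[(size p).+1]/(size (y :: p)) -(card_uniqP up) (eq_card ep).
have : y \in S :\: starts E S m by rewrite -ep mem_head.
rewrite inE => /andP[/negP nY _]; case: nY; apply/startsP; exists (take m p); split.
- by rewrite size_takel.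
- exact: take_path.
- by move: up => /= /andP[yp up]; rewrite take_uniq // andbT; apply: contra yp; apply: mem_take.
- move=> x xin; have : x \in S :\: starts E S m.
    by rewrite -ep; move: xin; rewrite !inE => /orP[->//|/mem_take->]; rewrite orbT.
  by rewrite inE => /andP[].
Qed.

(** If instead [b] dominated [y], then [b] would be a start too. Off the path from [y], it can be
    put in front and the last vertex dropped. *)
Lemma starts_dominate (S : {set T}) m y b :
  y \in starts E S m -> b \in S :\: starts E S m -> E y b.
Proof.
move=> yY; rewrite inE => /andP[bY bS].
have neq : b != y by apply: contraNneq bY => ->.
have [//|nE] := boolP (E y b).
have Eby : E b y by apply: tournament_neg nE; rewrite eq_sym.
case/negP: bY; apply/startsP.
have /startsP[p [sp pp up subp]] := yY.
have [bp|bp] := boolP (b \in p); last first.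
  case: m sp {yY} => [|m] sp.
    by exists [::]; split=> // x; rewrite inE => /eqP->.
  exists (y :: take m p); split.
  - by rewrite /= size_takel // sp.
  - by rewrite /= Eby take_path.
  - move: up => /= /andP[yp up]; rewrite inE !negb_or neq take_uniq //= andbT.
    by apply/andP; split; [apply: contra bp|apply: contra yp]; apply: mem_take.
  - move=> x; rewrite inE => /orP[/eqP->//|xin]; apply: subp.
    by move: xin; rewrite !inE => /orP[->//|/mem_take->]; rewrite orbT.
(* When the path is [y :: p1 ++ b :: p2], the path [b :: y :: p1] absorbs [p2] through the arc
   leaving [b], giving a path on the same vertices that starts at [b]. *)
case/splitPr: bp pp up subp sp => p1 p2.
rewrite cat_path /= => /and3P[pp1 _ pp2] up subp sp.
have pe : perm_eq (b :: (y :: p1) ++ p2) (y :: p1 ++ b :: p2).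
  by rewrite -[y :: p1 ++ _]cat_cons perm_sym perm_catC /= perm_cons perm_catC.
have [||||q pq eq] := @extend_path b (y :: p1) b p2.
- by rewrite /= Eby.
- by rewrite mem_head.
- by [].
- by rewrite (perm_uniq pe).
have pe' : perm_eq (b :: q) (y :: p1 ++ b :: p2).
  by apply: perm_trans pe; rewrite perm_cons.
exists q; split=> //.
- by apply: succn_inj; rewrite -sp; move/perm_size: pe'.
- exact: etrans (perm_uniq pe') up.
- by move=> x; rewrite (perm_mem pe'); apply: subp.
Qed.


Lemma card_outs_in (v : T) (S : {set T}) : #|outs E v :&: S| = \sum_(u in S) E v u.
Proof.
rewrite -sum1_card big_mkcond [RHS]big_mkcond /=; apply: eq_bigr => u _.
by rewrite !inE; case: (E v u); case: (u \in S).
Qed.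

End Tournament.

(** Reversing all arcs exchanges [k] and [l], which yields the dual of every one-sided argument. *)
Lemma converse_extension (T : finType) (E : rel T) k l :
  has_extension (converse E) l k -> has_extension E k l.
Proof.
case/extensionP=> c [p [q [sp sq /and4P[u srt pin qout]]]].
apply/extensionP; exists c, (rev q), (rev p); rewrite !size_rev; split=> //.
apply/and4P; rewrite -rev_cat rev_uniq !all_rev; split=> //.
by rewrite rev_sorted.
Qed.

(** * Structure around a vertex that is not the centre of a copy *)

Section Center.

Variables (T : finType) (E : rel T) (j m : nat) (s : T).
Hypothesis tourE : tournament E.
Hypothesis noext : ~~ has_extension E j.+1 m.+1.

(** Ends of paths are starts in the converse. [X] and [Y] are those of the overview, and [W] is the
    union of X and B. *)
Let X := starts (converse E) (ins E s) j.
Let Y := starts E (outs E s) m.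
Let W := X :|: (outs E s :\: Y).

(** An arc from [x] to [y] would join a path ending at [x] to one starting at [y], a copy centred at
    [s]. *)
Lemma starts_backward x y : x \in X -> y \in Y -> E y x.
Proof.
move=> xX yY; have xin := subsetP (starts_sub _ _ _) _ xX.
have yout := subsetP (starts_sub _ _ _) _ yY.
apply: (tournament_neg tourE).
  by apply: contraTneq xin => ->; rewrite (disjointFl (outs_ins_disjoint tourE s) yout).
apply/negP => Exy; case/negP: noext.
have /startsP[p [sp pp up subp]] := xX.
have /startsP[q [sq pq uq subq]] := yY.
apply: (@long_extension _ _ tourE _ _ s (rev (x :: p)) (y :: q)) => //.
- by rewrite size_rev /= sp.
- by rewrite /= sq.
- by rewrite rev_uniq.
- apply: sorted_join => //; first by rewrite rev_sorted.
  by move=> p' x' y' q'; rewrite rev_cons => /rcons_inj[_ <-] [<-].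
- by move=> z; rewrite mem_rev; apply: subp.
Qed.

Lemma starts_to_rest y z : y \in Y -> z \in W -> E y z.
Proof.
move=> yY; rewrite inE => /orP[zX|zB]; first exact: starts_backward.
exact: starts_dominate zB.
Qed.

(** Otherwise [y] is the centre of a copy. As [y] dominates [W], its in-neighbours lie in A or [Y],
    apart from [s]. A Hamiltonian path of them that ends in [Y] continues into one of [W]; [y']
    ensures that it can end in [Y]. *)
Lemma small_indegree y y' :
  m < #|W| -> y \in Y -> y' \in Y -> E y' y -> #|ins E y| <= j.
Proof.
move=> ltm yY y'Y Ey'y; rewrite leqNgt; apply/negP => ltj; case/negP: noext.
have tourE' := tournament_converse tourE.
have [p1 [up1 ep1 sp1]] := hamiltonian_path tourE (ins E y :&: (ins E s :\: X)).
have [p2 [up2 ep2 sp2]] := hamiltonian_path tourE (ins E y :&: Y).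
have [q [uq eq sq]] := hamiltonian_path tourE W.
have Yout z : z \in Y -> E s z.
  by move/(subsetP (starts_sub _ _ _)); rewrite inE.
(* A Hamiltonian path of the in-neighbourhood of [y] that ends in [Y]. *)
pose p := p1 ++ s :: p2.
have ep : p =i ins E y.
  move=> z; rewrite mem_cat inE ep1 ep2 !in_setI in_setD.
  have [->|zs] := eqVneq z s; first by rewrite orbT inE [RHS]Yout.
  case zy: (z \in ins E y) => //=.
  have zW : z \notin W.
    apply/negP => /(starts_to_rest yY) Eyz; move: zy; rewrite inE => Ezy.
    exact: tournament_asym Ezy Eyz.
  move: zW; rewrite in_setU in_setD; case: (z \in X) => //=.
  case: (z \in Y); rewrite /= ?orbT // orbF.
  by rewrite !inE => nE; apply: (tournament_neg tourE) nE; rewrite eq_sym.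
have p1in z : z \in p1 -> E z s.
  by rewrite ep1 !in_setI in_setD => /and3P[_ _]; rewrite inE.
have up : uniq p.
  rewrite cat_uniq up1 /= up2 andbT; apply/andP; split; last first.
    by apply/negP; rewrite ep2 in_setI => /andP[_ /Yout]; rewrite tournament_irr.
  apply/norP; split; first by apply/negP => /p1in; rewrite tournament_irr.
  apply/hasPn => z; rewrite ep2 in_setI => /andP[_ /Yout Esz].
  by apply/negP => /p1in Ezs; apply: tournament_asym Ezs Esz.
have sp : sorted E p.
  apply: sorted_join => //.
    rewrite /= path_min_sorted //; apply/allP => z.
    by rewrite ep2 in_setI => /andP[_ /Yout].
  by move=> p' x z q' ep' [<- _]; apply: p1in; rewrite ep' mem_rcons mem_head.
apply: (@long_extension _ _ tourE _ _ y p q) => //.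
- by rewrite -(card_uniqP up) (eq_card ep).
- by rewrite -(card_uniqP uq) (eq_card eq).
- apply: sorted_join => // p' x z q' ep' eq'.
  apply: starts_to_rest; last by rewrite -eq eq' mem_head.
  have y'p2 : y' \in p2 by rewrite ep2 in_setI y'Y andbT inE.
  have -> : x = last y' p2.
    have -> : x = last y' p by rewrite ep' last_rcons.
    by rewrite last_cat /=; case: (p2) y'p2.
  by have := mem_last y' p2; rewrite inE ep2 in_setI => /orP[/eqP->|/andP[]].
- by move=> z; rewrite ep.
- by move=> z; rewrite eq => /(starts_to_rest yY); rewrite [z \in outs E y]inE.
Qed.

(** Both A and [Y] dominate [x], so its out-neighbours lie in [W] without [x], together with [s]: at
    most as many vertices as [W] has. *)
Lemma small_outdegree x : #|W| <= m -> x \in X -> #|outs E x| <= m.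
Proof.
move=> leW xX; apply: leq_trans leW; rewrite (cardsD1 x W) inE xX add1n.
have sub : outs E x \subset s |: W :\ x.
  apply/subsetP => z; rewrite inE => Exz.
  have nzx : ~~ E z x by apply/negP => Ezx; apply: tournament_asym Ezx Exz.
  have zx : z != x by apply: contraTneq Exz => ->; rewrite tournament_irr.
  rewrite in_setU1 in_setD1 zx /=; have [//|zs /=] := eqVneq z s.
  rewrite in_setU in_setD; case: (boolP (z \in X)) => //= nzX.
  apply/andP; split; first by apply: contra nzx; apply: starts_backward.
  rewrite inE; apply: (tournament_neg tourE) => //; apply/negP => Ezs.
  case/negP: nzx; apply: (starts_dominate (tournament_converse tourE) xX).
  by rewrite inE nzX inE.
by apply: leq_trans (subset_leq_card sub) _; rewrite cardsU1; case: (_ \notin _).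
Qed.

End Center.

(** * Counting arcs *)

Lemma card_disjointU (T : finType) (A B : {set T}) :
  [disjoint A & B] -> #|A :|: B| = #|A| + #|B|.
Proof. by move=> dis; apply/eqP; rewrite (leq_card_setU A B).2. Qed.

Section Counting.

Variables (T : finType) (E : rel T).
Hypothesis tourE : tournament E.

Lemma card_outs_ins v : #|outs E v| + #|ins E v| = #|T|.-1.
Proof.
rewrite addnC -card_disjointU; last exact: outs_ins_disjoint.
rewrite -(cardsC1 v); apply: eq_card => x; rewrite !inE.
have [->|neq] := eqVneq x v; first by rewrite /converse !(tournament_irr tourE) ?eqxx.
by have := (proj2 tourE) x v neq; rewrite /converse; case: (E x v).
Qed.

(** Count the arcs inside [H] once by head and once by tail. *)
Lemma sum_ins_in (H : {set T}) :
  2 * \sum_(h in H) #|ins E h :&: H| = #|H| * #|H|.-1.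
Proof.
have eqs : \sum_(h in H) #|ins E h :&: H| = \sum_(h in H) #|outs E h :&: H|.
  under eq_bigr do rewrite card_outs_in.
  by rewrite exchange_big /=; apply: eq_bigr => h _; rewrite card_outs_in.
rewrite mul2n -addnn {1}eqs -big_split /= -sum_nat_const; apply: eq_bigr => h hH.
have -> : #|H|.-1 = #|H :\ h| by rewrite (cardsD1 h H) hH.
rewrite -card_disjointU; last first.
  rewrite -setI_eq0 setIACA (setIC (outs E h)).
  by rewrite (disjoint_setI0 (outs_ins_disjoint tourE h)) set0I.
apply: eq_card => x; rewrite !inE -andb_orl; case: (x \in H); rewrite ?andbF ?andbT //.
have [->|neq] := eqVneq x h; first by rewrite /converse !(tournament_irr tourE) ?eqxx.
by have := (proj2 tourE) x h neq; rewrite /converse; case: (E x h); rewrite ?orbT ?orbF.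
Qed.

(** The arcs from [G] to [H] and those inside [H] all have heads in [H], at most [j] for each
    head. *)
Lemma sum_outs_in (H G : {set T}) j : [disjoint H & G] ->
  (forall h, h \in H -> #|ins E h :&: (H :|: G)| <= j) ->
  2 * (\sum_(s in G) #|outs E s :&: H|) + #|H| * #|H|.-1 <= 2 * (#|H| * j).
Proof.
move=> dis bnd; rewrite -sum_ins_in -mulnDr leq_mul2l /=.
have -> : \sum_(s in G) #|outs E s :&: H| = \sum_(h in H) #|ins E h :&: G|.
  under eq_bigr do rewrite card_outs_in.
  by rewrite exchange_big /=; apply: eq_bigr => h _; rewrite card_outs_in.
rewrite -big_split -sum_nat_const /=; apply: leq_sum => h /bnd; apply: leq_trans.
rewrite setIUr card_disjointU; last first.
  by rewrite -setI_eq0 setIACA (disjoint_setI0 dis) setI0.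
by rewrite addnC.
Qed.

End Counting.

(** * Thin pairs and the upper bound for 0 < k < n *)

(** The pair of the overview without its two containments, for k = j + 1 and l = m + 1. *)
Definition thin_pair (T : finType) (E : rel T) (j m : nat) (H Z : {set T}) : bool :=
  [&& [disjoint H & Z],
      [forall h in H, #|ins E h :\: Z| <= j] & [forall z in Z, #|outs E z :\: H| <= m]].

Lemma thin_pair_converse (T : finType) (E : rel T) j m (H Z : {set T}) :
  thin_pair (converse E) m j Z H = thin_pair E j m H Z.
Proof. by rewrite /thin_pair disjoint_sym [X in _ && X]andbC. Qed.

Lemma thin_pair_grow (T : finType) (E : rel T) j m (H Z : {set T}) s :
  thin_pair E j m H Z -> s \notin Z -> #|ins E s :\: Z| <= j ->
  thin_pair E j m (s |: H) Z.
Proof.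
move=> /and3P[dis /forall_inP hH /forall_inP hZ] sZ les; apply/and3P; split.
- by rewrite -setI_eq0 setIUl (disjoint_setI0 dis) setU0 setI_eq0 disjoints1.
- by apply/forall_inP => h; rewrite in_setU1 => /predU1P[->|/hH].
- apply/forall_inP => z /hZ; apply: leq_trans; apply: subset_leq_card.
  by apply: setDS; apply: subsetU1.
Qed.

Section GoodVertex.

Variables (T : finType) (E : rel T) (j m : nat) (H Z : {set T}) (s : T).
Hypothesis tourE : tournament E.
Hypothesis noext : ~~ has_extension E j.+1 m.+1.
Hypothesis lowH : forall v, #|ins E v| <= j -> v \in H.
Hypothesis highZ : forall v, #|outs E v| <= m -> v \in Z.
Hypothesis ins_s : j < #|ins E s :\: Z|.

Lemma card_starts_le :
  #|starts E (outs E s) m| <= #|outs E s :&: H|.+1.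
Proof.
set Y := starts _ _ _.
(* Otherwise X is contained in [Z], and [ins_s] contradicts the bound on the in-neighbours outside
   X. *)
have ltm : m < #|starts (converse E) (ins E s) j :|: (outs E s :\: Y)|.
  rewrite ltnNge; apply/negP => leW; move: ins_s; rewrite ltnNge => /negP[].
  apply: leq_trans (card_not_starts (tournament_converse tourE) (ins E s) j).
  apply/subset_leq_card/setDS/subsetP => x xX; apply: highZ.
  exact: small_outdegree xX.
(* Of two vertices of [Y], the head of the arc between them has small indegree, hence lies in
   [H]. *)
have one : #|Y :\: H| <= 1.
  apply/card_le1_eqP => y y'; rewrite !in_setD => /andP[yH yY] /andP[y'H y'Y].
  apply/eqP; apply: contraNT yH => neq; apply: lowH.
  apply: (small_indegree tourE noext ltm yY y'Y).
  rewrite eq_sym in neq; apply: (tournament_neg tourE neq).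
  apply: contra y'H => Eyy'; apply: lowH.
  exact: (small_indegree tourE noext ltm y'Y yY).
rewrite -(cardsID H Y) -addn1; apply: leq_add one.
by apply/subset_leq_card/setSI/starts_sub.
Qed.

End GoodVertex.

(** Here [p] is 2j + 1 - h, given by a sum to avoid truncated subtraction. *)
Lemma half_arcs_bound a h j : 2 * a + h * h.-1 <= 2 * (h * j) ->
  exists2 p, h + p = j.*2.+1 & 2 * a <= h * p.
Proof.
move=> le; have lh : h <= j.*2.+1 by rewrite leqNgt; apply/negP => lt; nia.
exists (j.*2.+1 - h); first lia.
have [p ep] : exists p, h + p = j.*2.+1 by exists (j.*2.+1 - h); lia.
by rewrite (_ : _ - h = p); [nia|lia].
Qed.

(** With k = j + 1 and l = m + 1 the order is 2n - 1, and [0 < j + m] says n > 2. *)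
Lemma middle_extension (T : finType) (E : rel T) j m : tournament E ->
  0 < j + m -> #|T| = (2 * (j + m)).+3 -> has_extension E j.+1 m.+1.
Proof.
move=> tourE jm0 cardT; apply: contraT => noext.
have tourE' := tournament_converse tourE.
have noext' : ~~ has_extension (converse E) m.+1 j.+1.
  by apply: contra noext => /(@converse_extension _ E).
have degs v : #|outs E v| + #|ins E v| = (2 * (j + m)).+2.
  by rewrite card_outs_ins // cardT.
pose low := [set v | #|ins E v| <= j]; pose high := [set v | #|outs E v| <= m].
pose P (HZ : {set T} * {set T}) :=
  [&& low \subset HZ.1, high \subset HZ.2 & thin_pair E j m HZ.1 HZ.2].
have P0 : P (low, high).
  rewrite /P /= !subxx /=; apply/and3P; split.
  - apply/pred0P => v /=; rewrite !inE; apply/negP => /andP[]; move: (degs v); lia.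
  - apply/forall_inP => h; rewrite inE; apply: leq_trans.
    exact/subset_leq_card/subsetDl.
  - apply/forall_inP => h; rewrite inE; apply: leq_trans.
    exact/subset_leq_card/subsetDl.
have [[H Z] /= /and3P[/= lowH highZ thin] max] :=
  arg_maxnP (fun HZ : {set T} * {set T} => #|HZ.1| + #|HZ.2|) P0.
have {}lowH v : #|ins E v| <= j -> v \in H.
  by move=> le; apply: (subsetP lowH); rewrite inE.
have {}highZ v : #|outs E v| <= m -> v \in Z.
  by move=> le; apply: (subsetP highZ); rewrite inE.
have [disHZ /forall_inP hH /forall_inP hZ] := and3P thin.
pose G := ~: (H :|: Z).
have good s : s \in G -> j + m <= #|outs E s :&: H| + #|ins E s :&: Z|.
  rewrite !inE negb_or => /andP[sH sZ].
  (* Otherwise [s] could be added to [H], against maximality; dually for [outs_s] and [Z]. *)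
  have ins_s : j < #|ins E s :\: Z|.
    rewrite ltnNge; apply/negP => le.
    have /= := max (s |: H, Z); rewrite cardsU1 sH add1n addSn ltnn => /(_ _)/negP[] //.
    rewrite /P /= (thin_pair_grow thin) // andbT; apply/andP; split; apply/subsetP => v.
      by rewrite inE in_setU1 => /lowH->; rewrite orbT.
    by rewrite inE => /highZ.
  have outs_s : m < #|outs E s :\: H|.
    rewrite ltnNge; apply/negP => le.
    have /= := max (H, s |: Z); rewrite cardsU1 sZ add1n addnS ltnn => /(_ _)/negP[] //.
    have thin' : thin_pair (converse E) m j Z H by rewrite thin_pair_converse.
    rewrite /P /= -thin_pair_converse (thin_pair_grow thin' sH le) andbT.
    apply/andP; split; apply/subsetP => v.
      by rewrite inE => /lowH.
    by rewrite inE in_setU1 => /highZ->; rewrite orbT.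
  (* Since |A| <= j and |B| <= m, the degree sum 2(j + m) + 2 leaves |X| + |Y| >= j + m + 2, and
     each of X and Y loses at most one vertex. *)
  have leY := card_starts_le tourE noext lowH highZ ins_s.
  have leX := card_starts_le tourE' noext' highZ lowH outs_s.
  have := card_not_starts tourE (outs E s) m.
  have := card_not_starts tourE' (ins E s) j.
  have := cardsID (starts E (outs E s) m) (outs E s).
  have := cardsID (starts (converse E) (ins E s) j) (ins E s).
  rewrite (setIidPr (starts_sub _ _ _)) (setIidPr (starts_sub _ _ _)).
  move: leX leY (degs s); rewrite /outs /converse; lia.
have disHG : [disjoint H & G].
  by rewrite /G setCU -setI_eq0 setIA setICr set0I.
have disZG : [disjoint Z & G].
  by rewrite /G setUC setCU -setI_eq0 setIA setICr set0I.
have bH h : h \in H -> #|ins E h :&: (H :|: G)| <= j.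
  move/hH; apply: leq_trans; apply: subset_leq_card.
  apply/subsetP => x; rewrite !inE negb_or => /andP[-> /orP[xH|/andP[_ ->]]] //.
  by rewrite (disjointFr disHZ xH).
have bZ z : z \in Z -> #|outs E z :&: (Z :|: G)| <= m.
  move/hZ; apply: leq_trans; apply: subset_leq_card.
  apply/subsetP => x; rewrite !inE negb_or => /andP[-> /orP[xZ|/andP[-> _]]] //.
  by rewrite (disjointFl disHZ xZ).
have sumH := sum_outs_in tourE disHG bH.
have sumZ := sum_outs_in tourE' disZG bZ.
have : #|G| * (j + m) <= \sum_(s in G) #|outs E s :&: H| + \sum_(s in G) #|ins E s :&: Z|.
  by rewrite -big_split -sum_nat_const; apply: leq_sum => s /good.
have : #|H| + #|Z| + #|G| = (2 * (j + m)).+3.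
  by rewrite -cardT -(cardsC (H :|: Z)) card_disjointU.
move: sumH sumZ; set a := \sum_(s in G) _; set b := \sum_(s in G) _.
(* Put N = j + m. Then |G| = p + q + 1, while 2(a + b) <= |H|p + |Z|q <= (2N + 1)(p + q) - p^2 - q^2
   <= 2N(p + q). This contradicts N|G| <= a + b, as N > 0. *)
move=> /half_arcs_bound[p hp leH] /half_arcs_bound[q zq leZ] total le.
have expand x : (j + m).*2.+1 * x = 2 * ((j + m) * x) + x.
  by rewrite mulSn -mul2n -mulnA addnC.
have leHp : #|H| * p + p * p <= 2 * ((j + m) * p) + p.
  by rewrite -expand -mulnDl leq_mul2r; lia.
have leZq : #|Z| * q + q * q <= 2 * ((j + m) * q) + q.
  by rewrite -expand -mulnDl leq_mul2r; lia.
have eG : #|G| = (p + q).+1 by lia.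
have pp : p <= p * p by case: (p) => // p'; rewrite leq_pmulr.
have qq : q <= q * q by case: (q) => // q'; rewrite leq_pmulr.
rewrite eG mulnC mulnSr mulnDr in le.
move: leH leZ leHp leZq le pp qq jm0; clear.
move: (#|H| * p) (#|Z| * q) (p * p) (q * q) ((j + m) * p) ((j + m) * q) => *; lia.
Qed.

(** * Upper bound for a source or a sink *)

(** The average outdegree is l - 1/2, so some vertex has at least [l] out-neighbours, and these
    carry a Hamiltonian path. *)
Lemma source_extension (T : finType) (E : rel T) l : tournament E ->
  0 < l -> #|T| = 2 * l -> has_extension E 0 l.
Proof.
move=> tourE l0 cardT.
have [v lev] : exists v, l <= #|outs E v|.
  apply/existsP; apply: contraT => /existsPn lt.
  have := sum_ins_in (tournament_converse tourE) [set: T].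
  have : \sum_(h in [set: T]) #|ins (converse E) h :&: [set: T]| <= #|T| * l.-1.
    rewrite -cardsT -sum_nat_const; apply: leq_sum => h _.
    by rewrite setIT -ltnS prednK // ltnNge; apply: lt.
  rewrite cardsT cardT => le eq; move: le; rewrite -(leq_pmul2l (isT : 0 < 2)) eq.
  by case: l l0 {lt eq cardT} => // l _; rewrite /=; nia.
have [q [uq eq sq]] := hamiltonian_path tourE (outs E v).
apply: (@long_extension _ _ tourE _ _ v [::] q) => // [|x]; last by rewrite eq.
by rewrite -(card_uniqP uq) (eq_card eq).
Qed.

Lemma sink_extension (T : finType) (E : rel T) k : tournament E ->
  0 < k -> #|T| = 2 * k -> has_extension E k 0.
Proof.
move=> tourE k0 cardT; apply: converse_extension.
exact: source_extension (tournament_converse tourE) k0 cardT.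
Qed.

(** * Regular tournaments and the lower bound construction *)

(** The subtraction is modulo 2M + 1, an odd number, so exactly one of a nonzero residue and its
    opposite lies between 1 and M. *)
Definition rotational (M : nat) : rel 'I_(2 * M).+1 :=
  fun i j => 0 < (j - i)%R <= M.

Lemma rotational_tournament M : tournament (@rotational M).
Proof.
split=> [i|i j neq]; first by rewrite /rotational GRing.subrr.
rewrite /rotational -(GRing.opprB j i).
have : (j - i)%R != 0%R by rewrite GRing.subr_eq0 eq_sym.
move: (j - i)%R => x; rewrite -val_eqE /= => x0.
rewrite modn_small; have := ltn_ord x; lia.
Qed.

Lemma rotational_degree M (i : 'I_(2 * M).+1) :
  #|outs (@rotational M) i| <= M /\ #|ins (@rotational M) i| <= M.
Proof.
pose S := [set x : 'I_(2 * M).+1 | 0 < x <= M].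
have leS : #|S| <= M.
  have sub : S \subset [set inord x.+1 | x : 'I_M].
    apply/subsetP => x; rewrite inE => /andP[x0 xM].
    have xlt : x.-1 < M by rewrite prednK.
    apply/imsetP; exists (Ordinal xlt) => //; apply: val_inj.
    by rewrite /= inordK prednK //.
  rewrite -[X in _ <= X]card_ord; apply: leq_trans (subset_leq_card sub) _.
  exact: leq_imset_card.
split; apply: leq_trans leS.
  have sub : outs (@rotational M) i \subset [set (i + x)%R | x in S].
    apply/subsetP => j; rewrite inE => Eij; apply/imsetP; exists (j - i)%R.
      by rewrite inE.
    by rewrite GRing.addrC GRing.subrK.
  exact: leq_trans (subset_leq_card sub) (leq_imset_card _ _).
have sub : ins (@rotational M) i \subset [set (i - x)%R | x : 'I_(2 * M).+1 in S].
  apply/subsetP => j; rewrite inE => Eij; apply/imsetP; exists (i - j)%R.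
    by rewrite inE.
  by rewrite GRing.opprB GRing.addrC GRing.subrK.
exact: leq_trans (subset_leq_card sub) (leq_imset_card _ _).
Qed.

Lemma regular_tournament m : exists (T : finType) (E : rel T),
  [/\ tournament E, #|T| = 2 * m - 1 & forall v, #|outs E v| < m /\ #|ins E v| < m].
Proof.
(* For [m = 0] the truncated [2 * m - 1] is 0, and the empty tournament serves. *)
case: m => [|M].
  by exists void, (fun _ _ => false); split=> [|//|//]; [split|rewrite card_void].
exists 'I_(2 * M).+1, (@rotational M); split.
- exact: rotational_tournament.
- by rewrite card_ord; lia.
- by move=> v; rewrite !ltnS; apply: rotational_degree.
Qed.

Definition dominating_sum (S T : finType) (E : rel S) (F : rel T) : rel (S + T) :=
  fun x y => match x, y with
             | inl a, inl b => E a b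
             | inr a, inr b => F a b
             | inl _, inr _ => true
             | inr _, inl _ => false
             end.

(** Arcs into the first summand start there, and arcs out of the second end there. If [k] or [l] is
    0, one summand is empty and the order is one larger than 2(k + l) - 2; this separates the two
    values of unv. *)
Lemma extremal_tournament k l : exists (T : finType) (E : rel T),
  [/\ tournament E, #|T| = (2 * k - 1) + (2 * l - 1)
    & forall v, #|ins E v| < k \/ #|outs E v| < l].
Proof.
have [S [E [[irrE totE] cardS degE]]] := regular_tournament k.
have [T [F [[irrF totF] cardT degF]]] := regular_tournament l.
exists (S + T)%type, (dominating_sum E F); split.
- by split=> [[]|[a|a] [b|b]] //=; [apply: totE|apply: totF].
- by rewrite card_sum cardS cardT.
- case=> v; [left|right].
    apply: leq_ltn_trans (proj2 (degE v)).
    rewrite -(card_imset _ (@inl_inj S T)); apply: subset_leq_card.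
    apply/subsetP => -[] a; rewrite inE //= => Eav.
    by apply: imset_f; rewrite inE.
  apply: leq_ltn_trans (proj1 (degF v)).
  rewrite -(card_imset _ (@inr_inj S T)); apply: subset_leq_card.
  apply/subsetP => -[] a; rewrite inE //= => Eav.
  by apply: imset_f; rewrite inE.
Qed.

(** * Normal form of a full 1-extension *)

Lemma widen_ord_inj m n (le_m_n : m <= n) : injective (widen_ord le_m_n).
Proof. by move=> i j /(congr1 (@nat_of_ord n)) eqij; apply: val_inj. Qed.

(** [h i] is the path vertex v_i of the overview; the clauses determine [D] completely. *)
Definition shape (V : finType) (D : rel V) (s : V) (n k : nat) (h : 'I_n -> V) : Prop :=
  [/\ k <= n, injective h, forall i, h i != s & forall x, x != s -> exists i, x = h i] /\
  [/\ D s s = false, forall i, D (h i) s = (i < k), forall i, D s (h i) = (k <= i)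
    & forall i j, D (h i) (h j) = (j == i.+1 :> nat)].

Section Shape.

Variables (V : finType) (D : rel V) (s : V) (n k : nat) (h : 'I_n -> V).
Hypothesis shapeD : shape D s k h.

Lemma shape_card : #|V| = n.+1.
Proof.
have [[_ injh hs surj] _] := shapeD.
rewrite -cardsT (cardsD1 s) inE add1n -[in RHS](card_ord n) -(card_imset _ injh).
congr _.+1; apply: eq_card => x; rewrite !inE andbT.
apply/idP/imsetP => [/surj[i ->]|[i _ ->]]; [by exists i|exact: hs].
Qed.

Lemma shape_contains (T : finType) (E : rel T) : tournament E ->
  has_extension E k (n - k) -> contains E D.
Proof.
move=> tourE /extensionP[c [p [q [sp sq /and4P[upq spq /allP pin /allP qout]]]]].
have [[kn injh hs surj] [Dss Dhs Dsh Dhh]] := shapeD.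
have szr : size (p ++ q) = n by rewrite size_cat sp sq subnKC.
(* Only [s] is missed by [h], so the last branch sends [s] to the centre [c]. *)
pose f x := if [pick i | h i == x] is Some i then nth c (p ++ q) i else c.
have fs : f s = c.
  by rewrite /f; case: pickP => // i; rewrite (negPf (hs i)).
have fh i : f (h i) = nth c (p ++ q) i.
  by rewrite /f; case: pickP => [j /eqP/injh->//|/(_ i)]; rewrite eqxx.
have ine i : i < k -> E (nth c (p ++ q) i) c.
  move=> ik; rewrite nth_cat sp ik.
  have : nth c p i \in ins E c by apply: pin; rewrite mem_nth ?sp.
  by rewrite inE.
have oute i : k <= i -> i < n -> E c (nth c (p ++ q) i).
  move=> ki ilt; rewrite nth_cat sp ltnNge ki /=.
  have : nth c q (i - k) \in outs E c by apply: qout; rewrite mem_nth ?sq //; lia.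
  by rewrite inE.
have neqc (i : 'I_n) : nth c (p ++ q) i != c.
  apply/eqP => eqc; have [ik|ki] := ltnP i k.
    by have := ine i ik; rewrite eqc tournament_irr.
  by have := oute i ki (ltn_ord i); rewrite eqc tournament_irr.
exists f.
  move=> x y; have [->|/surj[i ->]] := eqVneq x s; have [->|/surj[j ->]] := eqVneq y s => //.
  - by rewrite fs fh => eqc; have := neqc j; rewrite -eqc eqxx.
  - by rewrite fs fh => eqc; have := neqc i; rewrite eqc eqxx.
  - rewrite !fh => /eqP; rewrite nth_uniq ?szr // => /eqP eqij.
    by congr h; apply: val_inj.
move=> x y; have [->|/surj[i ->]] := eqVneq x s; have [->|/surj[j ->]] := eqVneq y s.
- by rewrite Dss.
- by rewrite Dsh fs fh => /oute; apply.
- by rewrite Dhs fs fh; apply: ine.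
- rewrite Dhh !fh => /eqP ej; rewrite ej; move/(sortedP c): spq; apply.
  by rewrite szr -ej.
Qed.

(** The lower bound uses only the degrees at the image of [s]. *)
Lemma contains_shape (T : finType) (E : rel T) : contains E D ->
  exists c, k <= #|ins E c| /\ n - k <= #|outs E c|.
Proof.
have [[kn injh hs surj] [Dss Dhs Dsh Dhh]] := shapeD.
case=> f injf homf; exists (f s).
have injfh : injective (f \o h) by apply: inj_comp.
split.
  rewrite -[k](card_ord k) -(card_imset _ (inj_comp injfh (@widen_ord_inj _ _ kn))).
  apply/subset_leq_card/subsetP => _ /imsetP[i _ ->].
  by rewrite inE; apply: homf; rewrite Dhs /= ltn_ord.
pose g (i : 'I_(n - k)) : 'I_n := cast_ord (subnKC kn) (rshift k i).
have injg : injective g by move=> i j /cast_ord_inj/rshift_inj.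
rewrite -[n - k]card_ord -(card_imset _ (inj_comp injfh injg)).
apply/subset_leq_card/subsetP => _ /imsetP[i _ ->].
by rewrite inE; apply: homf; rewrite Dsh /= leq_addr.
Qed.

Lemma shape_unv N :
  (forall (T : finType) (E : rel T), tournament E -> #|T| = N ->
     has_extension E k (n - k)) ->
  N <= ((2 * k - 1) + (2 * (n - k) - 1)).+1 -> is_unv D N.
Proof.
move=> upper lower; split=> [T E tourE cardT|p unavp].
  exact/shape_contains/upper.
have [T [E [[irrE totE] cardT deg]]] := extremal_tournament k (n - k).
rewrite leqNgt; apply/negP => ltp.
have lep : p <= #|T| by rewrite cardT -ltnS; apply: leq_trans ltp lower.
(* Any [p] vertices of [T] induce a tournament, and a copy in it is a copy in [T]. *)
pose g (i : 'I_p) : T := enum_val (widen_ord lep i).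
have injg : injective g by move=> i j /enum_val_inj/widen_ord_inj.
have tourg : tournament (relpre g E).
  by split=> [i|i j neq]; [apply: irrE|apply: totE; rewrite (inj_eq injg)].
have [f injf homf] := unavp _ _ tourg (card_ord p).
have : contains E D by exists (g \o f) => //; apply: inj_comp.
case/contains_shape => c [lein leout]; case: (deg c); lia.
Qed.

End Shape.

Lemma full_one_extension_shape (V : finType) (D : rel V) (s : V) :
  full_one_extension D s -> exists n k (h : 'I_n -> V), 0 < n /\ shape D s k h.
Proof.
case=> acyc [n n0 [f [g fK gK] monof]] full; pose h i := val (g i).
have hs i : h i != s by apply: (valP (g i)).
have Dhh i j : D (h i) (h j) = (j == i.+1 :> nat).
  by have := monof (g i) (g j); rewrite !gK.
have Dss : D s s = false.
  by apply/negP => Dss; have := acyc [:: s]; rewrite /= Dss => /(_ isT).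
have walk (i j : 'I_n) : i <= j ->
    exists2 q, path D (h i) q & last (h i) q = h j.
  move=> leij; have [d ed] : exists d, j = i + d :> nat by exists (j - i); rewrite subnKC.
  elim: d j ed {leij} => [|d IH] j ed.
    by exists [::] => //=; congr h; apply: val_inj; rewrite /= ed addn0.
  have lt : i + d < n by have := ltn_ord j; lia.
  have [q pq lq] := IH (Ordinal lt) erefl.
  by exists (rcons q (h j)); rewrite ?last_rcons // rcons_path pq lq Dhh /= ed addnS.
(* Otherwise [s], followed by the path from [h i] to [h j], closes a cycle. *)
have order (i j : 'I_n) : D (h j) s -> i <= j -> D (h i) s.
  move=> Djs /walk[q pq lq]; have := full (h i) (hs i).
  have [//|_ /=] := boolP (D (h i) s); rewrite addbF => Dsi.
  by have := acyc [:: s, h i & q]; rewrite /= rcons_path Dsi pq lq Djs => /(_ isT).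
(* The least such [k] is the number of in-neighbours of [s], by [order]. *)
have exk : exists k, [forall i : 'I_n, (k <= i) ==> ~~ D (h i) s].
  by exists n; apply/forallP => i; rewrite leqNgt ltn_ord.
case: (ex_minnP exk) => k /forallP kP kmin.
have Dhs i : D (h i) s = (i < k).
  apply/idP/idP => [Dis|ik].
    by rewrite ltnNge; apply: contraTN Dis => ki; apply: (implyP (kP i)).
  case: k ik {kP} kmin => // k ik kmin.
  have : ~~ [forall i : 'I_n, (k <= i) ==> ~~ D (h i) s].
    by apply/negP => /kmin; rewrite ltnn.
  case/forallPn => j; rewrite negb_imply negbK => /andP[kj Djs].
  by apply: (order i j Djs); apply: leq_trans kj.
exists n, k, h; split=> //; split; split=> //.
- by apply: kmin; apply/forallP => i; rewrite leqNgt ltn_ord.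
- by move=> i j /val_inj/(can_inj gK).
- by move=> x xs; exists (f (Sub x xs)); rewrite /h fK.
- move=> i; have := full (h i) (hs i); rewrite Dhs.
  by case: ltnP; case: (D s (h i)).
Qed.

(** * The transitive tournament on three vertices *)

Lemma ord2_cases (i : 'I_2) : i = ord0 \/ i = ord_max.
Proof. by case: i => -[|[|//]] lt; [left|right]; apply: val_inj. Qed.

Lemma shape_TT3 (V : finType) (D : rel V) (s : V) (h : 'I_2 -> V) :
  shape D s 1 h -> digraph_iso D (transitive_tournament 3).
Proof.
move=> shapeD; have [[_ injh hs _] [Dss Dhs Dsh Dhh]] := shapeD.
(* The transitive order is v_0, s, v_1. *)
pose g (i : 'I_3) := if i == 0 :> nat then h ord0 else if i == 1 :> nat then s else h ord_max.
have h01 : h ord0 != h ord_max by rewrite (inj_eq injh).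
have mono : {mono g : i j / transitive_tournament 3 i j >-> D i j}.
  by move=> [[|[|[|//]]] i] [[|[|[|//]]] j]; rewrite /g /= ?Dss ?Dhs ?Dsh ?Dhh.
have injg : injective g.
  move=> [[|[|[|//]]] i] [[|[|[|//]]] j]; rewrite /g /= => /eqP eqg; apply: val_inj => //=;
  move: eqg; rewrite ?(negPf (hs _)) ?(negPf h01) // eq_sym ?(negPf (hs _)) ?(negPf h01) //.
have [f gK fK] : bijective g.
  by apply: inj_card_bij injg _; rewrite (shape_card shapeD) card_ord.
by exists f; [exists g|move=> x y; rewrite -mono !fK].
Qed.

(** The source v_0 can serve as the added vertex, with s, v_1 as the path; this reduces TT_3 to the
    source case. *)
Lemma shape_TT3_source (V : finType) (D : rel V) (s : V) (h : 'I_2 -> V) :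
  shape D s 1 h -> exists h', shape D (h ord0) 0 (h' : 'I_2 -> V).
Proof.
move=> [[_ injh hs surj] [Dss Dhs Dsh Dhh]].
have h01 : h ord0 != h ord_max by rewrite (inj_eq injh).
exists (fun i => if i == ord0 then s else h ord_max); split; split=> //.
- move=> i j; have [->|->] := ord2_cases i; have [->|->] := ord2_cases j => //= /eqP.
    by rewrite eq_sym (negPf (hs _)).
  by rewrite (negPf (hs _)).
- by move=> i; have [->|->] := ord2_cases i => //=; rewrite eq_sym.
- move=> x; have [->|/surj[i ->]] := eqVneq x s; first by exists ord0.
  by have [->|-> _] := ord2_cases i; [rewrite eqxx|exists ord_max].
- by move=> i; have [->|->] := ord2_cases i; rewrite /= ?Dsh ?Dhh.
- by move=> i; have [->|->] := ord2_cases i; rewrite /= ?Dhs ?Dhh.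
- by move=> i j; have [->|->] := ord2_cases i; have [->|->] := ord2_cases j;
    rewrite /= ?Dss ?Dsh ?Dhs ?Dhh.
Qed.

Theorem theorem31 (V : finType) (D : rel V) (s : V)
    (hD : full_one_extension D s) :
  (is_source D s \/ is_sink D s \/ digraph_iso D (transitive_tournament 3) ->
     is_unv D (2 * #|V| - 2)) /\
  (~ (is_source D s \/ is_sink D s \/
      digraph_iso D (transitive_tournament 3)) ->
     is_unv D (2 * #|V| - 3)).
Proof.
have [n [k [h [n0 shapeD]]]] := full_one_extension_shape hD.
have cardV := shape_card shapeD.
have [[kn _ _ surj] [Dss Dhs Dsh _]] := shapeD.
have unv_source (s' : V) n' (h' : 'I_n' -> V) : 0 < n' -> shape D s' 0 h' ->
    is_unv D (2 * n').
  move=> n'0 shape'; apply: (shape_unv shape'); last lia.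
  by move=> T E tourE cardT; rewrite subn0; apply: source_extension.
have source_k : k = 0 -> is_unv D (2 * n).
  by move=> k0; rewrite k0 in shapeD; apply: unv_source shapeD.
have sink_k : k = n -> is_unv D (2 * n).
  move=> kn'; apply: (shape_unv shapeD); last by rewrite kn'; lia.
  by move=> T E tourE cardT; rewrite kn' subnn; apply: sink_extension.
have -> : 2 * #|V| - 2 = 2 * n by rewrite cardV; lia.
have -> : 2 * #|V| - 3 = 2 * n - 1 by rewrite cardV; lia.
split=> [[src|[snk|[f /bij_eq_card card3 _]]]|others].
- apply: source_k; apply/eqP; rewrite -leqn0 leqNgt; apply/negP => k0.
  by have := src (h (Ordinal n0)); rewrite Dhs k0.
- have lt : n.-1 < n by rewrite prednK.
  apply: sink_k; apply/eqP; rewrite eqn_leq kn leqNgt; apply/negP => ltk.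
  by have := snk (h (Ordinal lt)); rewrite Dsh /= -ltnS prednK // ltk.
- have n2 : n = 2 by move: card3; rewrite cardV card_ord => -[].
  (* As n = 2, the values 0 and 2 of [k] are the source and sink cases; for k = 1 the added vertex
     is exchanged. *)
  case: (ltngtP k 1) => [|lt1|k1].
  + by rewrite ltnS leqn0 => /eqP/source_k.
  + by apply: sink_k; lia.
  + move: shapeD; rewrite k1; clear -unv_source n2; move: h; rewrite n2 => h.
    by case/shape_TT3_source => h'; apply: unv_source.
- have [k0|k0] := posnP k.
    case: others; left => x; have [->|/surj[i ->]] := eqVneq x s; first by rewrite Dss.
    by rewrite Dhs k0.
  have [ltk|] := ltnP k n; last first.
    move=> nk; case: others; right; left => x.
    have [->|/surj[i ->]] := eqVneq x s; first by rewrite Dss.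
    by rewrite Dsh -ltnNge; apply: leq_trans nk.
  (* Since 0 < k < n, the only exception would be n = 2 and k = 1, which is TT_3. *)
  have n3 : 2 < n.
    rewrite ltnNge; apply/negP => n2; case: others; right; right.
    have [{}n2 k1] : n = 2 /\ k = 1 by lia.
    move: shapeD; rewrite k1; clear -n2; move: h; rewrite n2 => h.
    exact: shape_TT3.
  apply: (shape_unv shapeD); last lia.
  move=> T E tourE cardT; have [j [m [ej em]]] : exists j m, k = j.+1 /\ n - k = m.+1.
    by exists k.-1, (n - k).-1; lia.
  rewrite em ej; apply: middle_extension => //; lia.
Qed.
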